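(* Let $(X,\|\cdot\|)$ be a normed linear space, let $0<\alpha\le 1$, and let $x=\{x_n\}_{n\in\mathbb{N}}$ be a sequence in $X$. Then $x$ is statistically bounded of order $\alpha$ if and only if there exists a real number $r\ge 0$ such that $st\text{-}LIM_x^{r^{\alpha}}\neq\emptyset$.
   Context: Let $x=\{x_n\}_{n\in\mathbb{N}}$ be a sequence in a normed linear space $(X,\|\cdot\|)$, $0<\alpha\le 1$ and $r\ge 0$. The sequence $x$ is statistically bounded of order $\alpha$ if there is a real $M>0$ with $\lim_{n\to\infty}\frac{1}{n^{\alpha}}|\{k\le n:\|x_k\|\ge M\}|=0$. The sequence $x$ is rough statistically convergent of order $\alpha$ to $\xi\in X$ (with roughness degree $r$) if for every $\varepsilon>0$, $\lim_{n\to\infty}\frac{1}{n^{\alpha}}|\{k\le n:\|x_k-\xi\|\ge r+\varepsilon\}|=0$. The set of all such $\xi\in X$ is denoted $st\text{-}LIM_x^{r^{\alpha}}$. Here $|A|$ is the number of elements of $A$, and $r^{\alpha}$ in the notation is only a label recording $r$ and $\alpha$, not a power. *)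

(* Defs.v *)
From mathcomp Require Import all_boot all_order all_algebra.
From mathcomp Require Import all_classical all_reals all_analysis.

Set Implicit Arguments.
Unset Strict Implicit.
Unset Printing Implicit Defensive.

Import Order.TTheory GRing.Theory Num.Theory.
Import numFieldNormedType.Exports.

Local Open Scope classical_set_scope.
Local Open Scope ring_scope.

(* Sequences x_1, x_2, ... are functions on nat whose value at 0 is never
   used; the index set {k <= n} is accordingly {1, ..., n}. *)
Definition null_of_order (R : realType) (alpha : R) (P : pred nat) : Prop :=
  (fun n : nat => (n%:R `^ alpha)^-1 * (count P (index_iota 1 n.+1))%:R : R)
    @ \oo --> (0 : R).

Definition stat_bounded (R : realType) (X : normedModType R) (alpha : R)
    (x : nat -> X) : Prop :=
  exists2 M : R, 0 < M & null_of_order alpha (fun k => M <= `|x k|).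

Definition rough_stat_cvg (R : realType) (X : normedModType R) (alpha r : R)
    (x : nat -> X) (xi : X) : Prop :=
  forall eps : R, 0 < eps ->
    null_of_order alpha (fun k => r + eps <= `|x k - xi|).

Definition st_LIM (R : realType) (X : normedModType R) (alpha r : R)
    (x : nat -> X) : set X :=
  [set xi | rough_stat_cvg alpha r x xi].

(* Main.v *)
Require Import Defs.
From mathcomp Require Import all_boot all_order all_algebra.
From mathcomp Require Import all_classical all_reals all_analysis.

Import Order.TTheory GRing.Theory Num.Theory.
Import numFieldNormedType.Exports.

Local Open Scope classical_set_scope.
Local Open Scope ring_scope.

(** Nullity of order [alpha] passes to smaller index sets ([null_of_order_sub], by squeezing), so
    each direction reduces to one inclusion of index sets. A statistical bound [M] is itself a
    roughness degree, with rough limit 0; conversely, the triangle inequality turns a rough limit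
    [xi] into a bound. *)

Lemma null_of_order_sub (R : realType) (alpha : R) (P Q : pred nat) :
  subpred P Q -> null_of_order alpha Q -> null_of_order alpha P.
Proof.
move=> PQ Q0; apply: (squeeze_cvgr _ (cvg_cst 0) Q0).
near=> n; have w0 : 0 <= (n%:R `^ alpha)^-1 :> R by rewrite invr_ge0 powR_ge0.
by rewrite mulr_ge0 //= ler_wpM2l // ler_nat sub_count.
Unshelve. all: by end_near. Qed.

Theorem theorem3p1 (R : realType) (X : normedModType R) (alpha : R)
    (alpha_gt0 : 0 < alpha) (alpha_le1 : alpha <= 1) (x : nat -> X) :
  stat_bounded alpha x <->
  exists r : R, 0 <= r /\ st_LIM alpha r x <> set0.
Proof.
split=> [[M M0 xM]|[r [r0 /eqP/set0P[xi xxi]]]].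
  exists M; split; first exact: ltW.
  (* Around 0, a deviation of at least [M + eps] is in particular a norm of at least [M]. *)
  apply/eqP/set0P; exists 0 => eps eps0.
  apply: null_of_order_sub xM => k; rewrite subr0; apply: le_trans.
  by rewrite lerDl ltW.
(* The single choice [eps = 1] suffices, and makes the bound positive even when [r = 0] and
   [xi = 0]. *)
exists (r + 1 + `|xi|); first by rewrite ltr_wpDr // ltr_wpDl.
apply: null_of_order_sub (xxi 1 ltr01) => k; rewrite -lerBrDr => /le_trans; apply.
exact: lerB_dist.
Qed.
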